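(* There exists a one-to-one correspondence between skeletal 3-Lie2Der pairs and triples $((L,\theta_L),(V;\rho,\theta_V),(\alpha_3,\alpha_2))$, where $(L,\theta_L)$ is a 3-LieDer pair, $(V;\rho,\theta_V)$ is a representation of $(L,\theta_L)$, and $(\alpha_3,\alpha_2)$ is a 3-cocycle associated to the representation $(V;\rho,\theta_V)$.
   Context: Throughout, $\mathbb F$ is an algebraically closed field of characteristic $0$ and all vector spaces are finite-dimensional over $\mathbb F$. A 3-Lie algebra is a vector space $L$ with a skew-symmetric trilinear map $[\cdot,\cdot,\cdot]_L$ satisfying $[x_1,x_2,[x_3,x_4,x_5]]=[[x_1,x_2,x_3],x_4,x_5]+[x_3,[x_1,x_2,x_4],x_5]+[x_3,x_4,[x_1,x_2,x_5]]$. A derivation is a linear map $\theta_L:L\to L$ with $\theta_L[x,y,z]=[\theta_L x,y,z]+[x,\theta_L y,z]+[x,y,\theta_L z]$. A 3-LieDer pair $(L,\theta_L)$ is a 3-Lie algebra with a derivation. A representation $(V;\rho,\theta_V)$ of $(L,\theta_L)$ consists of a vector space $V$, a linear map $\rho:\wedge^2L\to\mathrm{End}(V)$ and $\theta_V\in\mathrm{End}(V)$ with $\rho(x_1,x_2)\rho(x_3,x_4)=\rho([x_1,x_2,x_3],x_4)+\rho(x_3,[x_1,x_2,x_4])+\rho(x_3,x_4)\rho(x_1,x_2)$, $\rho(x_1,[x_2,x_3,x_4])=\rho(x_3,x_4)\rho(x_1,x_2)-\rho(x_2,x_4)\rho(x_1,x_3)+\rho(x_2,x_3)\rho(x_1,x_4)$,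 and $\theta_V\rho(x,y)-\rho(x,y)\theta_V=\rho(\theta_Lx,y)+\rho(x,\theta_Ly)$. Cohomology: $C^1(L;V)=\mathrm{Hom}(L,V)$ and, for $p\ge2$, $C^p(L;V)=\mathrm{Hom}(\otimes^{p-1}(\wedge^2L)\wedge L,V)$, i.e. linear maps $\alpha(\mathfrak X_1,\dots,\mathfrak X_{p-1},z)$, $\mathfrak X_i=x_i\wedge y_i\in\wedge^2L$, $z\in L$, totally skew-symmetric in the last three arguments $x_{p-1},y_{p-1},z$. On $\wedge^2L$ let $[x_1\wedge x_2,y_1\wedge y_2]_F=[x_1,x_2,y_1]_L\wedge y_2+y_1\wedge[x_1,x_2,y_2]_L$ and $\theta_L(x\wedge y)=\theta_L(x)\wedge y+x\wedge\theta_L(y)$. Define $\mathrm d:C^p(L;V)\to C^{p+1}(L;V)$ by $$\begin{aligned}(\mathrm df)(\mathfrak X_1,\dots,\mathfrak X_p,z)=&\sum_{1\le j<k\le p}(-1)^jf(\mathfrak X_1,\dots,\widehat{\mathfrak X_j},\dots,\mathfrak X_{k-1},[\mathfrak X_j,\mathfrak X_k]_F,\mathfrak X_{k+1},\dots,\mathfrak X_p,z)\\&+\sum_{j=1}^p(-1)^jf(\mathfrak X_1,\dots,\widehat{\mathfrak X_j},\dots,\mathfrak X_p,[x_j,y_j,z]_L)+\sum_{j=1}^p(-1)^{j+1}\rho(\mathfrak X_j)f(\mathfrak X_1,\dots,\widehat{\mathfrak X_j},\dots,\mathfrak X_p,z)\\&+(-1)^{p+1}\rho(y_p,z)f(\mathfrak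 X_1,\dots,\mathfrak X_{p-1},x_p)+(-1)^p\rho(x_p,z)f(\mathfrak X_1,\dots,\mathfrak X_{p-1},y_p),\end{aligned}$$ and $\delta:C^p(L;V)\to C^p(L;V)$ by $(\delta\alpha)(\mathfrak X_1,\dots,\mathfrak X_{p-1},z)=\sum_{i=1}^{p-1}\alpha(\mathfrak X_1,\dots,\theta_L(\mathfrak X_i),\dots,\mathfrak X_{p-1},z)+\alpha(\mathfrak X_1,\dots,\mathfrak X_{p-1},\theta_L(z))-\theta_V(\alpha(\mathfrak X_1,\dots,\mathfrak X_{p-1},z))$. For $p\ge2$, $\mathcal C^p_{\rm 3-LieDer}(L;V)=C^p(L;V)\times C^{p-1}(L;V)$ with $\partial(\alpha_p,\beta_{p-1})=(\mathrm d\alpha_p,\mathrm d\beta_{p-1}+(-1)^p\delta\alpha_p)$. A 3-cocycle associated to $(V;\rho,\theta_V)$ is $(\alpha_3,\alpha_2)\in\mathcal C^3_{\rm 3-LieDer}(L;V)$ with $\partial(\alpha_3,\alpha_2)=0$. A 3-Lie 2-algebra $\mathcal V=(V_1,V_0,d,l_3,l_5)$ consists of a complex $V_1\xrightarrow{d}V_0$, completely skew-symmetric trilinear maps $l_3:V_i\times V_j\times V_k\to V_{i+j+k}$ ($0\le i+j+k\le1$), and a multilinear map $l_5:(\wedge^2V_0)\otimes(\wedge^3V_0)\to V_1$, such that for $x,y,x_i\in V_0$, $u,v,w\in V_1$: (a) $dl_3(x,y,u)=l_3(x,y,du)$; (b) $l_3(u,v,w)=0$, $l_3(u,v,x)=0$;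 (c) $l_3(du,v,x)=l_3(u,dv,x)$; (d) $dl_5(x_1,x_2,x_3,x_4,x_5)=l_3(l_3(x_1,x_2,x_3),x_4,x_5)+l_3(x_3,l_3(x_1,x_2,x_4),x_5)+l_3(x_3,x_4,l_3(x_1,x_2,x_5))-l_3(x_1,x_2,l_3(x_3,x_4,x_5))$; (e) $l_5(du,x_2,x_3,x_4,x_5)=l_3(l_3(u,x_2,x_3),x_4,x_5)+l_3(x_3,l_3(u,x_2,x_4),x_5)+l_3(x_3,x_4,l_3(u,x_2,x_5))-l_3(u,x_2,l_3(x_3,x_4,x_5))$; (f) $l_5(x_1,x_2,du,x_4,x_5)=l_3(l_3(x_1,x_2,u),x_4,x_5)+l_3(u,l_3(x_1,x_2,x_4),x_5)+l_3(u,x_4,l_3(x_1,x_2,x_5))-l_3(x_1,x_2,l_3(u,x_4,x_5))$; (g) $l_3(l_5(x_1,x_2,x_3,x_4,x_5),x_6,x_7)+l_3(x_5,l_5(x_1,x_2,x_3,x_4,x_6),x_7)+l_3(x_1,x_2,l_5(x_3,x_4,x_5,x_6,x_7))+l_3(x_5,x_6,l_5(x_1,x_2,x_3,x_4,x_7))+l_5(x_1,x_2,l_3(x_3,x_4,x_5),x_6,x_7)+l_5(x_1,x_2,x_5,l_3(x_3,x_4,x_6),x_7)+l_5(x_1,x_2,x_5,x_6,l_3(x_3,x_4,x_7))=l_3(x_3,x_4,l_5(x_1,x_2,x_5,x_6,x_7))+l_5(l_3(x_1,x_2,x_3),x_4,x_5,x_6,x_7)+l_5(x_3,l_3(x_1,x_2,x_4),x_5,x_6,x_7)+l_5(x_3,x_4,l_3(x_1,x_2,x_5),x_6,x_7)+l_5(x_3,x_4,x_5,l_3(x_1,x_2,x_6),x_7)+l_5(x_1,x_2,x_3,x_4,l_3(x_5,x_6,x_7))+l_5(x_3,x_4,x_5,x_6,l_3(x_1,x_2,x_7))$.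 It is skeletal if $d=0$. A 2-derivation of $\mathcal V$ is a triple $(X_0,X_1,l_X)$, $X_0\in\mathrm{End}(V_0)$, $X_1\in\mathrm{End}(V_1)$, $l_X:V_0\wedge V_0\wedge V_0\to V_1$ linear, such that for $x,y,z,x_i\in V_0$, $v\in V_1$: (a) $X_0\circ d=d\circ X_1$; (b) $dl_X(x,y,z)=X_0l_3(x,y,z)-l_3(X_0x,y,z)-l_3(x,X_0y,z)-l_3(x,y,X_0z)$; (c) $l_X(x,y,dv)=X_1l_3(x,y,v)-l_3(X_0x,y,v)-l_3(x,X_0y,v)-l_3(x,y,X_1v)$; (d) $X_1l_5(x_1,\dots,x_5)=l_X(l_3(x_1,x_2,x_3),x_4,x_5)+l_X(x_3,l_3(x_1,x_2,x_4),x_5)+l_X(x_3,x_4,l_3(x_1,x_2,x_5))-l_X(x_1,x_2,l_3(x_3,x_4,x_5))+l_3(l_X(x_1,x_2,x_3),x_4,x_5)+l_3(x_3,l_X(x_1,x_2,x_4),x_5)+l_3(x_3,x_4,l_X(x_1,x_2,x_5))-l_3(x_1,x_2,l_X(x_3,x_4,x_5))+\sum_{i=1}^5l_5(x_1,\dots,X_0(x_i),\dots,x_5)$. A 3-Lie2Der pair $(\mathcal V;(X_0,X_1,l_X))$ is a 3-Lie 2-algebra with a 2-derivation; a skeletal 3-Lie2Der pair is one with $\mathcal V$ skeletal. *)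

(* Defs.v *)
From HB Require Import structures.
From mathcomp Require Import all_boot all_order all_algebra.

Set Implicit Arguments.
Unset Strict Implicit.
Unset Printing Implicit Defensive.

Import GRing.Theory.
Local Open Scope ring_scope.

(* A linear map out of an exterior power is represented, through the universal
   property, by a skew-symmetric multilinear function of its arguments. *)

Definition bilinear2 (F : fieldType) (U1 U2 W : vectType F)
    (f : U1 -> U2 -> W) : Prop :=
  (forall y, linear (fun x => f x y)) /\ (forall x, linear (fun y => f x y)).

Definition trilinear (F : fieldType) (U1 U2 U3 W : vectType F)
    (f : U1 -> U2 -> U3 -> W) : Prop :=
  [/\ forall y z, linear (fun x => f x y z),
      forall x z, linear (fun y => f x y z)
    & forall x y, linear (fun z => f x y z)].

Definition quinquelinear (F : fieldType) (U W : vectType F)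
    (f : U -> U -> U -> U -> U -> W) : Prop :=
  [/\ forall x2 x3 x4 x5, linear (fun x => f x x2 x3 x4 x5),
      forall x1 x3 x4 x5, linear (fun x => f x1 x x3 x4 x5),
      forall x1 x2 x4 x5, linear (fun x => f x1 x2 x x4 x5),
      forall x1 x2 x3 x5, linear (fun x => f x1 x2 x3 x x5)
    & forall x1 x2 x3 x4, linear (fun x => f x1 x2 x3 x4 x)].

Definition skew2 (F : fieldType) (U W : vectType F) (f : U -> U -> W) : Prop :=
  forall x y, f y x = - f x y.

Definition skew3 (F : fieldType) (U W : vectType F)
    (f : U -> U -> U -> W) : Prop :=
  (forall x y z, f y x z = - f x y z) /\ (forall x y z, f x z y = - f x y z).

Record lie3 (F : fieldType) (L : vectType F) := Lie3 {
  bracket : L -> L -> L -> L;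
  bracket_trilinear : trilinear bracket;
  bracket_skew : skew3 bracket;
  bracket_fundamental : forall x1 x2 x3 x4 x5,
    bracket x1 x2 (bracket x3 x4 x5) =
      bracket (bracket x1 x2 x3) x4 x5 + bracket x3 (bracket x1 x2 x4) x5
      + bracket x3 x4 (bracket x1 x2 x5) }.

Record lie3Der (F : fieldType) (L : vectType F) := Lie3Der {
  lie3_of : lie3 L;
  theta : 'End(L);
  theta_derivation : forall x y z,
    theta (bracket lie3_of x y z) =
      bracket lie3_of (theta x) y z + bracket lie3_of x (theta y) z
      + bracket lie3_of x y (theta z) }.

Definition br (F : fieldType) (L : vectType F) (P : lie3Der L) :
    L -> L -> L -> L :=
  bracket (lie3_of P).

Record representation (F : fieldType) (L : vectType F) (P : lie3Der L)
    (V : vectType F) := Representation {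
  rho : L -> L -> 'End(V);
  rho_bilinear : bilinear2 rho;
  rho_skew : skew2 rho;
  thetaV : 'End(V);
  rho_rho : forall x1 x2 x3 x4,
    (rho x1 x2 \o rho x3 x4)%VF =
      rho (br P x1 x2 x3) x4 + rho x3 (br P x1 x2 x4)
      + (rho x3 x4 \o rho x1 x2)%VF;
  rho_bracket : forall x1 x2 x3 x4,
    rho x1 (br P x2 x3 x4) =
      (rho x3 x4 \o rho x1 x2)%VF - (rho x2 x4 \o rho x1 x3)%VF
      + (rho x2 x3 \o rho x1 x4)%VF;
  rho_theta : forall x y,
    (thetaV \o rho x y)%VF - (rho x y \o thetaV)%VF =
      rho (theta P x) y + rho x (theta P y) }.

(* Wedge slots are numbered from 0: an argument (X_1, ..., X_n) of n
   decomposable bivectors x_i /\ y_i is X : {ffun 'I_n -> L * L}. *)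

Definition upd (T : Type) (n : nat) (X : {ffun 'I_n -> T}) (i : 'I_n) (w : T) :
    {ffun 'I_n -> T} :=
  [ffun k => if k == i then w else X k].

Definition hat (T : Type) (n : nat) (j : 'I_n) (X : {ffun 'I_n -> T}) :
    {ffun 'I_n.-1 -> T} :=
  [ffun k => X (lift j k)].

Definition is_cochain (F : fieldType) (L V : vectType F) (n : nat)
    (f : {ffun 'I_n -> L * L} -> L -> V) : Prop :=
  [/\ forall X i y z, linear (fun x => f (upd X i (x, y)) z),
      forall X i x z, linear (fun y => f (upd X i (x, y)) z),
      forall X, linear (f X),
      forall X i x y z, f (upd X i (y, x)) z = - f (upd X i (x, y)) z
    & forall X (i : 'I_n) x y z, i.+1 = n ->
        f (upd X i (x, z)) y = - f (upd X i (x, y)) z].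

(* [cochain L V n] is C^(n+1)(L;V): the degree p is one more than the number
   of wedge slots. *)
Record cochain (F : fieldType) (L V : vectType F) (n : nat) := Cochain {
  cochain_fun :> {ffun 'I_n -> L * L} -> L -> V;
  cochainP : is_cochain cochain_fun }.

(* The differential d : C^p -> C^(p+1), with p = n.+1.  Since [X_j, X_k]_F is a
   sum of two decomposable bivectors, each f(.., [X_j, X_k]_F, ..) is the sum of
   two values of f.  The 0-based j stands for the index j.+1 of the formula. *)
Definition cobord (F : fieldType) (L V : vectType F) (P : lie3Der L)
    (R : representation P V) (n : nat) (f : {ffun 'I_n -> L * L} -> L -> V)
    (X : {ffun 'I_n.+1 -> L * L}) (z : L) : V :=
  let x i := (X i).1 in
  let y i := (X i).2 in
  let p := n.+1 in
  \sum_(j < p) \sum_(k < p | (j < k)%N) (-1) ^+ j.+1 *: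
      (f (hat j (upd X k (br P (x j) (y j) (x k), y k))) z
       + f (hat j (upd X k (x k, br P (x j) (y j) (y k)))) z)
  + \sum_(j < p) (-1) ^+ j.+1 *: f (hat j X) (br P (x j) (y j) z)
  + \sum_(j < p) (-1) ^+ j.+2 *: rho R (x j) (y j) (f (hat j X) z)
  + (-1) ^+ p.+1 *: rho R (y ord_max) z (f (hat ord_max X) (x ord_max))
  + (-1) ^+ p *: rho R (x ord_max) z (f (hat ord_max X) (y ord_max)).

(* delta : C^p -> C^p, with p = n.+1; theta (x /\ y) is a sum of two
   decomposable bivectors. *)
Definition delta (F : fieldType) (L V : vectType F) (P : lie3Der L)
    (R : representation P V) (n : nat) (f : {ffun 'I_n -> L * L} -> L -> V)
    (X : {ffun 'I_n -> L * L}) (z : L) : V :=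
  \sum_(i < n) (f (upd X i (theta P (X i).1, (X i).2)) z
                + f (upd X i ((X i).1, theta P (X i).2)) z)
  + f X (theta P z) - thetaV R (f X z).

(* The differential of the total complex on C^p x C^(p-1), with p = n.+2. *)
Definition partial (F : fieldType) (L V : vectType F) (P : lie3Der L)
    (R : representation P V) (n : nat)
    (ab : cochain L V n.+1 * cochain L V n) :
    ({ffun 'I_n.+2 -> L * L} -> L -> V) * ({ffun 'I_n.+1 -> L * L} -> L -> V) :=
  let p := n.+2 in
  (cobord R ab.1,
   fun X z => cobord R ab.2 X z + (-1) ^+ p *: delta R ab.1 X z).

Record cocycle3 (F : fieldType) (L V : vectType F) (P : lie3Der L)
    (R : representation P V) := Cocycle3 {
  alpha3 : cochain L V 2;
  alpha2 : cochain L V 1;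
  partial1_eq0 : forall X z, (partial R (alpha3, alpha2)).1 X z = 0;
  partial2_eq0 : forall X z, (partial R (alpha3, alpha2)).2 X z = 0 }.

Record triple_on (F : fieldType) (L V : vectType F) := TripleOn {
  tr_pair : lie3Der L;
  tr_rep : representation tr_pair V;
  tr_cocycle : cocycle3 tr_rep }.

Record triple (F : fieldType) := Triple {
  tr_L : vectType F;
  tr_V : vectType F;
  tr_structure : triple_on tr_L tr_V }.

(* The maps l_3 : V_i x V_j x V_k -> V_(i+j+k) are gathered in one map on the
   total space V0 * V1.  It is skew-symmetric in the plain sense: a Koszul sign
   would only show up for two arguments of degree 1, where l_3 vanishes by
   axiom (b). *)

Definition dg0 (F : fieldType) (V0 V1 : vectType F) (x : V0) :
  (V0 * V1)%type := (x, 0).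
Definition dg1 (F : fieldType) (V0 V1 : vectType F) (u : V1) :
  (V0 * V1)%type := (0, u).
Arguments dg0 {F V0 V1} x.
Arguments dg1 {F V0 V1} u.

Definition c000 (F : fieldType) (V0 V1 : vectType F)
    (l : V0 * V1 -> V0 * V1 -> V0 * V1 -> V0 * V1) (x y z : V0) : V0 :=
  (l (dg0 x) (dg0 y) (dg0 z)).1.
Definition c001 (F : fieldType) (V0 V1 : vectType F)
    (l : V0 * V1 -> V0 * V1 -> V0 * V1 -> V0 * V1) (x y : V0) (u : V1) : V1 :=
  (l (dg0 x) (dg0 y) (dg1 u)).2.
Definition c010 (F : fieldType) (V0 V1 : vectType F)
    (l : V0 * V1 -> V0 * V1 -> V0 * V1 -> V0 * V1) (x : V0) (u : V1) (y : V0) :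
    V1 :=
  (l (dg0 x) (dg1 u) (dg0 y)).2.
Definition c100 (F : fieldType) (V0 V1 : vectType F)
    (l : V0 * V1 -> V0 * V1 -> V0 * V1 -> V0 * V1) (u : V1) (x y : V0) : V1 :=
  (l (dg1 u) (dg0 x) (dg0 y)).2.

Record lie3_2alg (F : fieldType) (V0 V1 : vectType F) := Lie3_2alg {
  diff : 'Hom(V1, V0);
  l3 : V0 * V1 -> V0 * V1 -> V0 * V1 -> V0 * V1;
  l5 : V0 -> V0 -> V0 -> V0 -> V0 -> V1;
  l3_trilinear : trilinear l3;
  l3_skew : skew3 l3;
  l3_degree0 : forall x y z, (l3 (dg0 x) (dg0 y) (dg0 z)).2 = 0;
  l3_degree1 : forall x y u, (l3 (dg0 x) (dg0 y) (dg1 u)).1 = 0;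
  l5_linear : quinquelinear l5;
  l5_skew12 : forall x3 x4 x5, skew2 (fun x1 x2 => l5 x1 x2 x3 x4 x5);
  l5_skew345 : forall x1 x2, skew3 (l5 x1 x2);
  axiom_a : forall x y u, diff (c001 l3 x y u) = c000 l3 x y (diff u);
  axiom_b3 : forall u v w, l3 (dg1 u) (dg1 v) (dg1 w) = 0;
  axiom_b2 : forall u v x, l3 (dg1 u) (dg1 v) (dg0 x) = 0;
  axiom_c : forall u v x, c010 l3 (diff u) v x = c100 l3 u (diff v) x;
  axiom_d : forall x1 x2 x3 x4 x5,
    diff (l5 x1 x2 x3 x4 x5) =
      c000 l3 (c000 l3 x1 x2 x3) x4 x5 + c000 l3 x3 (c000 l3 x1 x2 x4) x5
      + c000 l3 x3 x4 (c000 l3 x1 x2 x5) - c000 l3 x1 x2 (c000 l3 x3 x4 x5);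
  axiom_e : forall u x2 x3 x4 x5,
    l5 (diff u) x2 x3 x4 x5 =
      c100 l3 (c100 l3 u x2 x3) x4 x5 + c010 l3 x3 (c100 l3 u x2 x4) x5
      + c001 l3 x3 x4 (c100 l3 u x2 x5) - c100 l3 u x2 (c000 l3 x3 x4 x5);
  axiom_f : forall x1 x2 u x4 x5,
    l5 x1 x2 (diff u) x4 x5 =
      c100 l3 (c001 l3 x1 x2 u) x4 x5 + c100 l3 u (c000 l3 x1 x2 x4) x5
      + c100 l3 u x4 (c000 l3 x1 x2 x5) - c001 l3 x1 x2 (c100 l3 u x4 x5);
  axiom_g : forall x1 x2 x3 x4 x5 x6 x7,
    c100 l3 (l5 x1 x2 x3 x4 x5) x6 x7 + c010 l3 x5 (l5 x1 x2 x3 x4 x6) x7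
    + c001 l3 x1 x2 (l5 x3 x4 x5 x6 x7) + c001 l3 x5 x6 (l5 x1 x2 x3 x4 x7)
    + l5 x1 x2 (c000 l3 x3 x4 x5) x6 x7 + l5 x1 x2 x5 (c000 l3 x3 x4 x6) x7
    + l5 x1 x2 x5 x6 (c000 l3 x3 x4 x7) =
      c001 l3 x3 x4 (l5 x1 x2 x5 x6 x7) + l5 (c000 l3 x1 x2 x3) x4 x5 x6 x7
      + l5 x3 (c000 l3 x1 x2 x4) x5 x6 x7 + l5 x3 x4 (c000 l3 x1 x2 x5) x6 x7
      + l5 x3 x4 x5 (c000 l3 x1 x2 x6) x7 + l5 x1 x2 x3 x4 (c000 l3 x5 x6 x7)
      + l5 x3 x4 x5 x6 (c000 l3 x1 x2 x7) }.

Definition skeletal (F : fieldType) (V0 V1 : vectType F)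
    (A : lie3_2alg V0 V1) : Prop :=
  diff A = 0.

Record derivation2 (F : fieldType) (V0 V1 : vectType F)
    (A : lie3_2alg V0 V1) := Derivation2 {
  der0 : 'End(V0);
  der1 : 'End(V1);
  lX : V0 -> V0 -> V0 -> V1;
  lX_trilinear : trilinear lX;
  lX_skew : skew3 lX;
  der_a : (der0 \o diff A)%VF = (diff A \o der1)%VF;
  der_b : forall x y z,
    diff A (lX x y z) =
      der0 (c000 (l3 A) x y z) - c000 (l3 A) (der0 x) y z
      - c000 (l3 A) x (der0 y) z - c000 (l3 A) x y (der0 z);
  der_c : forall x y v,
    lX x y (diff A v) =
      der1 (c001 (l3 A) x y v) - c001 (l3 A) (der0 x) y v
      - c001 (l3 A) x (der0 y) v - c001 (l3 A) x y (der1 v);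
  der_d : forall x1 x2 x3 x4 x5,
    der1 (l5 A x1 x2 x3 x4 x5) =
      lX (c000 (l3 A) x1 x2 x3) x4 x5 + lX x3 (c000 (l3 A) x1 x2 x4) x5
      + lX x3 x4 (c000 (l3 A) x1 x2 x5) - lX x1 x2 (c000 (l3 A) x3 x4 x5)
      + c100 (l3 A) (lX x1 x2 x3) x4 x5 + c010 (l3 A) x3 (lX x1 x2 x4) x5
      + c001 (l3 A) x3 x4 (lX x1 x2 x5) - c001 (l3 A) x1 x2 (lX x3 x4 x5)
      + (l5 A (der0 x1) x2 x3 x4 x5 + l5 A x1 (der0 x2) x3 x4 x5
         + l5 A x1 x2 (der0 x3) x4 x5 + l5 A x1 x2 x3 (der0 x4) x5
         + l5 A x1 x2 x3 x4 (der0 x5)) }.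

Record skeletal_pair_on (F : fieldType) (V0 V1 : vectType F) :=
  SkeletalPairOn {
    sp_alg : lie3_2alg V0 V1;
    sp_skeletal : skeletal sp_alg;
    sp_der : derivation2 sp_alg }.

Record skeletal_pair (F : fieldType) := SkeletalPair {
  sp_V0 : vectType F;
  sp_V1 : vectType F;
  sp_structure : skeletal_pair_on sp_V0 sp_V1 }.

(* A skeletal pair on (V0, V1) and a triple with L = V0, V = V1 carry the same
   data. *)
Definition same_data (F : fieldType) (V0 V1 : vectType F)
    (S : skeletal_pair_on V0 V1) (T : triple_on V0 V1) : Prop :=
  let A := sp_alg S in
  let D := sp_der S in
  let P := tr_pair T in
  let R := tr_rep T in
  let c := tr_cocycle T in
  (forall x y z, br P x y z = c000 (l3 A) x y z)
  /\ theta P = der0 D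
  /\ (forall x y u, rho R x y u = c001 (l3 A) x y u)
  /\ thetaV R = der1 D
  /\ (forall (X : {ffun 'I_2 -> V0 * V0}) z,
        alpha3 c X z = l5 A (X ord0).1 (X ord0).2 (X ord_max).1 (X ord_max).2 z)
  /\ (forall (X : {ffun 'I_1 -> V0 * V0}) z,
        alpha2 c X z = lX D (X ord0).1 (X ord0).2 z).

(* Main.v *)
Require Import Defs.
From HB Require Import structures.
From mathcomp Require Import all_boot all_order all_algebra.
From mathcomp Require Import boolp ring.

Set Implicit Arguments.
Unset Strict Implicit.
Unset Printing Implicit Defensive.

Import GRing.Theory.
Local Open Scope ring_scope.

(** Both structures live on the same two spaces, L = V0 and V = V1, and the
    relation [same_data] says that they have the same structure maps: the
    bracket is l_3 on V0, rho is l_3 with one argument in V1, alpha_3 is l_5,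
    alpha_2 is l_X, and theta_L, theta_V are X_0, X_1. The theorem amounts to
    saying that [same_data] is the graph of a bijection.

    The axioms match one by one once d = 0. Every term of the 2-algebra and
    2-derivation axioms that contains d vanishes, so that (a) and (c) of the
    2-algebra and (a) of the 2-derivation become empty, while (d) becomes the
    fundamental identity of the bracket, (e) and (f) the two axioms of a
    representation, (b) of the 2-derivation the Leibniz rule for theta_L and
    (c) the compatibility of theta_V with rho. The remaining axioms are the
    cocycle equation: (g) is d alpha_3 = 0 and (d) of the 2-derivation is
    d alpha_2 - delta alpha_3 = 0. The last two identifications rest on the
    explicit low-degree formulas [cobord5E], [cobord3E] and [delta5E].

    A map l_3 on the total space V0 + V1 is not just a bracket and an action:
    [l3E] shows that skew-symmetry, the degree conditions and the vanishing on
    two arguments of degree 1 make it determined by these two, and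
    [l3_of_triple] is the same formula read as a definition.

    Hence each S has a partner T ([triple_of_skeletalP]), each T has a partner
    S ([skeletal_of_tripleP]), and partners are unique on both sides
    ([same_data_inj_triple], [same_data_inj_skeletal]): equal structure maps
    give equal structures, since the axioms are propositions. The two
    constructions are therefore mutually inverse. *)

(** * Additive identities and linear maps *)

Lemma functionals_separate (F : fieldType) (V : vectType F) (u v : V) :
  (forall f : {linear V -> F^o}, f u = f v) -> u = v.
Proof.
move=> eq_uv; rewrite (coord_vbasis (memvf u)) (coord_vbasis (memvf v)).
by apply: eq_bigr => i _; rewrite (eq_uv (coord (vbasis fullv) i)).
Qed.

(** Deduces an identity from another one that is the same after moving terms
    across the equality; the side goal is then purely additive. *)
Lemma eq_of_subr (V : zmodType) (a b c d : V) : c = d -> a - b = c - d -> a = b.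
Proof. by move=> -> /eqP; rewrite subrr subr_eq0 => /eqP. Qed.

(** Proves an identity of abelian groups in V, up to reordering and
    cancellation of terms: a linear functional carries it to the ground field,
    where it is a commutative ring identity between the images of the terms. *)
Ltac additive :=
  apply: functionals_separate; let g := fresh "g" in
  move=> g; rewrite ?(raddfD, raddfN, raddf0) /=; ring.

Section MultilinearMaps.

Variables (F : fieldType) (U W : vectType F).

Lemma linear_fun0 (f : U -> W) : linear f -> f 0 = 0.
Proof.
by move=> f_lin; have := f_lin (-1) 0 0; rewrite scaler0 addr0 scaleN1r addNr.
Qed.

Definition lin_hom (f : U -> W) (f_lin : linear f) : 'Hom(U, W) :=
  linfun (HB.pack f (GRing.isLinear.Build F U W *:%R f f_lin) : {linear U -> W}).

Lemma lin_homE f f_lin : @lin_hom f f_lin =1 f.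
Proof. by move=> u; rewrite lfunE. Qed.

End MultilinearMaps.

(** * Cochains of low degree *)

Definition slots1 (T : Type) (a : T) : {ffun 'I_1 -> T} := [ffun=> a].
Definition slots2 (T : Type) (a b : T) : {ffun 'I_2 -> T} :=
  [ffun i : 'I_2 => nth a [:: a; b] i].
Definition slots3 (T : Type) (a b c : T) : {ffun 'I_3 -> T} :=
  [ffun i : 'I_3 => nth a [:: a; b; c] i].

Lemma slots1K (T : Type) (X : {ffun 'I_1 -> T}) : slots1 (X ord0) = X.
Proof. by apply/ffunP => i; rewrite ffunE (ord1 i). Qed.

Lemma slots2K (T : Type) (X : {ffun 'I_2 -> T}) :
  slots2 (X ord0) (X ord_max) = X.
Proof.
by apply/ffunP => -[[|[|//]] lti]; rewrite ffunE /=; congr (X _); apply: val_inj.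
Qed.

Lemma slots3K (T : Type) (X : {ffun 'I_3 -> T}) :
  slots3 (X ord0) (X (lift ord0 ord0)) (X ord_max) = X.
Proof.
by apply/ffunP => -[[|[|[|//]]] lti]; rewrite ffunE /=; congr (X _);
  apply: val_inj.
Qed.

Lemma upd_slots1 (T : Type) (a w : T) : upd (slots1 a) ord0 w = slots1 w.
Proof. by apply/ffunP => i; rewrite !ffunE (ord1 i). Qed.

Lemma upd_slots2_0 (T : Type) (a b w : T) :
  upd (slots2 a b) ord0 w = slots2 w b.
Proof. by apply/ffunP => -[[|[|//]] lti]; rewrite !ffunE. Qed.

Lemma upd_slots2_1 (T : Type) (a b w : T) :
  upd (slots2 a b) ord_max w = slots2 a w.
Proof. by apply/ffunP => -[[|[|//]] lti]; rewrite !ffunE. Qed.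

Section LowDegree.

Variables (F : fieldType) (L V : vectType F).

Definition cochain_of3 (f : L -> L -> L -> V) (X : {ffun 'I_1 -> L * L}) z :=
  f (X ord0).1 (X ord0).2 z.

Definition cochain_of5 (f : L -> L -> L -> L -> L -> V)
    (X : {ffun 'I_2 -> L * L}) z :=
  f (X ord0).1 (X ord0).2 (X ord_max).1 (X ord_max).2 z.

(** Cochains with one and with two wedge slots are the maps l_X and l_5: the
    skew-symmetry of the last slot together with the final argument supplies
    the second generator of the symmetric group on three letters. *)
Lemma cochain_of3P (f : L -> L -> L -> V) :
  is_cochain (cochain_of3 f) <-> trilinear f /\ skew3 f.
Proof.
rewrite /cochain_of3; split=> [[f1 f2 f3 s12 s23] | [[f1 f2 f3] [s12 s23]]].
  split; first split=> [y z a u v|x z a u v|x y]; last split=> x y z.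
  - by have := f1 (slots1 0) ord0 y z a u v; rewrite !upd_slots1 !ffunE.
  - by have := f2 (slots1 0) ord0 x z a u v; rewrite !upd_slots1 !ffunE.
  - by have := f3 (slots1 (x, y)); rewrite !ffunE.
  - by have := s12 (slots1 0) ord0 x y z; rewrite !upd_slots1 !ffunE.
  - by have := s23 (slots1 0) ord0 x y z erefl; rewrite !upd_slots1 !ffunE.
split=> [X i y z | X i x z | X | X i x y z | X i x y z _]; rewrite ?(ord1 i).
- by move=> a u v; rewrite !ffunE; exact: f1.
- by move=> a u v; rewrite !ffunE; exact: f2.
- exact: f3.
- by rewrite !ffunE /= -s12.
- by rewrite !ffunE /= -s23.
Qed.

Lemma cochain_of5P (f : L -> L -> L -> L -> L -> V) :
  is_cochain (cochain_of5 f) <->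
  [/\ quinquelinear f,
      forall x3 x4 x5, skew2 (fun x1 x2 => f x1 x2 x3 x4 x5)
    & forall x1 x2, skew3 (f x1 x2)].
Proof.
rewrite /cochain_of5.
split=> [[f1 f2 f3 s12 s23] | [[f1 f2 f3 f4 f5] s12 s345]].
  split; first split.
  - move=> x2 x3 x4 x5 a u v.
    by have := f1 (slots2 0 (x3, x4)) ord0 x2 x5 a u v;
      rewrite !upd_slots2_0 !ffunE.
  - move=> x1 x3 x4 x5 a u v.
    by have := f2 (slots2 0 (x3, x4)) ord0 x1 x5 a u v;
      rewrite !upd_slots2_0 !ffunE.
  - move=> x1 x2 x4 x5 a u v.
    by have := f1 (slots2 (x1, x2) 0) ord_max x4 x5 a u v;
      rewrite !upd_slots2_1 !ffunE.
  - move=> x1 x2 x3 x5 a u v.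
    by have := f2 (slots2 (x1, x2) 0) ord_max x3 x5 a u v;
      rewrite !upd_slots2_1 !ffunE.
  - move=> x1 x2 x3 x4.
    by have := f3 (slots2 (x1, x2) (x3, x4)); rewrite !ffunE.
  - move=> x3 x4 x5 x1 x2.
    by have := s12 (slots2 0 (x3, x4)) ord0 x1 x2 x5;
      rewrite !upd_slots2_0 !ffunE.
  move=> x1 x2; split=> x3 x4 x5.
    by have := s12 (slots2 (x1, x2) 0) ord_max x3 x4 x5;
      rewrite !upd_slots2_1 !ffunE.
  by have := s23 (slots2 (x1, x2) 0) ord_max x3 x4 x5 erefl;
    rewrite !upd_slots2_1 !ffunE.
split=> [X|X|X|X|X].
- by case=> [[|[|//]] lti] y z a u v; rewrite !ffunE; [exact: f1 | exact: f3].
- by case=> [[|[|//]] lti] y z a u v; rewrite !ffunE; [exact: f2 | exact: f4].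
- exact: f5.
- case=> [[|[|//]] lti] x y z; rewrite !ffunE /=; first exact: s12.
  exact: (s345 _ _).1.
- case=> [[|[|//]] lti] x y z // _; rewrite !ffunE /=.
  exact: (s345 _ _).2.
Qed.

Variables (P : lie3Der L) (R : representation P V).

(** The three formulas below expand [cobord] and [delta] in the degrees of a
    3-cocycle. On explicit slots the removal and the replacement of a wedge slot
    compute, so that only a rearrangement of terms is left. *)
Lemma cobord3E (f : L -> L -> L -> V) x1 x2 x3 x4 x5 :
  cobord R (cochain_of3 f) (slots2 (x1, x2) (x3, x4)) x5 =
  - f (br P x1 x2 x3) x4 x5 - f x3 (br P x1 x2 x4) x5
  - f x3 x4 (br P x1 x2 x5) + f x1 x2 (br P x3 x4 x5)
  + rho R x1 x2 (f x3 x4 x5) - rho R x3 x4 (f x1 x2 x5)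
  - rho R x4 x5 (f x1 x2 x3) + rho R x3 x5 (f x1 x2 x4).
Proof.
rewrite /cobord !big_ord_recl !big_ord0.
rewrite ![\sum_(k < _ | (_ < k)%N) _]big_mkcond /= /cochain_of3.
rewrite !big_ord_recl !big_ord0 /= !ffunE /=.
rewrite !exprS !expr0 !(mulr1, mulN1r, opprK) !(scaleN1r, scale1r).
by additive.
Qed.

Lemma delta5E (f : L -> L -> L -> L -> L -> V) x1 x2 x3 x4 x5 :
  delta R (cochain_of5 f) (slots2 (x1, x2) (x3, x4)) x5 =
  f (theta P x1) x2 x3 x4 x5 + f x1 (theta P x2) x3 x4 x5
  + f x1 x2 (theta P x3) x4 x5 + f x1 x2 x3 (theta P x4) x5
  + f x1 x2 x3 x4 (theta P x5) - thetaV R (f x1 x2 x3 x4 x5).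
Proof.
rewrite /delta !big_ord_recl !big_ord0 /= /cochain_of5 !ffunE /=.
by additive.
Qed.

Lemma cobord5E (f : L -> L -> L -> L -> L -> V) x1 x2 x3 x4 x5 x6 x7 :
  cobord R (cochain_of5 f) (slots3 (x1, x2) (x3, x4) (x5, x6)) x7 =
  - f (br P x1 x2 x3) x4 x5 x6 x7 - f x3 (br P x1 x2 x4) x5 x6 x7
  - f x3 x4 (br P x1 x2 x5) x6 x7 - f x3 x4 x5 (br P x1 x2 x6) x7
  + f x1 x2 (br P x3 x4 x5) x6 x7 + f x1 x2 x5 (br P x3 x4 x6) x7
  - f x3 x4 x5 x6 (br P x1 x2 x7) + f x1 x2 x5 x6 (br P x3 x4 x7)
  - f x1 x2 x3 x4 (br P x5 x6 x7)
  + rho R x1 x2 (f x3 x4 x5 x6 x7) - rho R x3 x4 (f x1 x2 x5 x6 x7)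
  + rho R x5 x6 (f x1 x2 x3 x4 x7) + rho R x6 x7 (f x1 x2 x3 x4 x5)
  - rho R x5 x7 (f x1 x2 x3 x4 x6).
Proof.
rewrite /cobord !big_ord_recl !big_ord0.
rewrite ![\sum_(k < _ | (_ < k)%N) _]big_mkcond /= /cochain_of5.
rewrite !big_ord_recl !big_ord0 /= !ffunE /=.
rewrite !exprS !expr0 !(mulr1, mulN1r, opprK) !(scaleN1r, scale1r).
by additive.
Qed.

End LowDegree.

(** * Components of l_3 on the total space *)

Section Degree.

Variables (F : fieldType) (V0 V1 : vectType F).
Implicit Types (x y z : V0) (u v : V1) (p q r : V0 * V1).

Lemma dg0_linear (a : F) x y : dg0 (a *: x + y) = a *: dg0 x + dg0 y :> V0 * V1.
Proof. by congr pair; rewrite /= scaler0 addr0. Qed.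

Lemma dg1_linear (a : F) u v : dg1 (a *: u + v) = a *: dg1 u + dg1 v :> V0 * V1.
Proof. by congr pair; rewrite /= scaler0 addr0. Qed.

Lemma dgE p : p = dg0 p.1 + dg1 p.2.
Proof. by case: p => x u; congr pair; rewrite /= ?addr0 ?add0r. Qed.

Section Alg.

Variable A : lie3_2alg V0 V1.

Lemma c000_trilinear : trilinear (c000 (l3 A)).
Proof.
by have [lin1 lin2 lin3] := l3_trilinear A; split=> *; move=> a u v;
  rewrite /c000 dg0_linear (lin1, lin2, lin3).
Qed.

Lemma c000_skew : skew3 (c000 (l3 A)).
Proof.
by split=> x y z; rewrite /c000; [rewrite (l3_skew A).1 | rewrite (l3_skew A).2].
Qed.

Lemma c001_trilinear : trilinear (c001 (l3 A)).
Proof.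
by have [lin1 lin2 lin3] := l3_trilinear A; split=> *; move=> a u v;
  rewrite /c001 (dg0_linear, dg1_linear) (lin1, lin2, lin3).
Qed.

Lemma c001_skew u : skew2 (fun x y => c001 (l3 A) x y u).
Proof. by move=> x y; rewrite /c001 (l3_skew A).1. Qed.

Lemma c010E x u y : c010 (l3 A) x u y = - c001 (l3 A) x y u.
Proof. by rewrite /c010 /c001 (l3_skew A).2. Qed.

Lemma c100E u x y : c100 (l3 A) u x y = c001 (l3 A) x y u.
Proof. by rewrite /c100 (l3_skew A).1 (l3_skew A).2 opprK. Qed.

(** Splitting each argument into its two homogeneous parts gives eight terms;
    the four with at least two arguments of degree 1 vanish, and skew-symmetry
    brings the three with exactly one such argument to a single component. *)
Lemma l3E p q r :
  l3 A p q r = (c000 (l3 A) p.1 q.1 r.1,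
    c001 (l3 A) p.1 q.1 r.2 - c001 (l3 A) p.1 r.1 q.2
    + c001 (l3 A) q.1 r.1 p.2).
Proof.
have [lin1 lin2 lin3] := l3_trilinear A; have [s12 s23] := l3_skew A.
have D1 q' r' p1 p2 : l3 A (p1 + p2) q' r' = l3 A p1 q' r' + l3 A p2 q' r'.
  by have := lin1 q' r' 1 p1 p2; rewrite !scale1r.
have D2 p' r' q1 q2 : l3 A p' (q1 + q2) r' = l3 A p' q1 r' + l3 A p' q2 r'.
  by have := lin2 p' r' 1 q1 q2; rewrite !scale1r.
have D3 p' q' r1 r2 : l3 A p' q' (r1 + r2) = l3 A p' q' r1 + l3 A p' q' r2.
  by have := lin3 p' q' 1 r1 r2; rewrite !scale1r.
have b2 u v x : l3 A (dg1 u) (dg0 x) (dg1 v) = 0.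
  by rewrite s23 axiom_b2 oppr0.
have b1 u v x : l3 A (dg0 x) (dg1 u) (dg1 v) = 0.
  by rewrite s12 b2 oppr0.
rewrite {1}(dgE p) {1}(dgE q) {1}(dgE r) !(D1, D2, D3).
rewrite axiom_b3 !axiom_b2 !b2 !b1 !addr0.
have s13 (u : V1) x y : l3 A (dg1 u) (dg0 x) (dg0 y) = l3 A (dg0 x) (dg0 y) (dg1 u).
  by rewrite s12 s23 opprK.
rewrite s13 (s23 _ _ (dg1 q.2)) [LHS]surjective_pairing /= !l3_degree0 !l3_degree1.
by rewrite !oppr0 !add0r !addr0 addrAC.
Qed.

End Alg.
End Degree.

Definition rho_of (F : fieldType) (V0 V1 : vectType F) (A : lie3_2alg V0 V1)
    (x y : V0) : 'End(V1) :=
  let: And3 _ _ c001_lin := c001_trilinear A in lin_hom (c001_lin x y).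

Lemma rho_ofE (F : fieldType) (V0 V1 : vectType F) (A : lie3_2alg V0 V1)
    (x y : V0) : rho_of A x y =1 c001 (l3 A) x y.
Proof. by move=> u; rewrite /rho_of; case: c001_trilinear => *; rewrite lin_homE. Qed.

(** * From a skeletal pair to a triple *)

Section SkeletalToTriple.

Variables (F : fieldType) (V0 V1 : vectType F) (S : skeletal_pair_on V0 V1).
Let A := sp_alg S.
Let D := sp_der S.

Lemma diff_skeletal u : diff A u = 0.
Proof. by rewrite (sp_skeletal S) lfunE. Qed.

Lemma fundamental_of_skeletal x1 x2 x3 x4 x5 :
  c000 (l3 A) x1 x2 (c000 (l3 A) x3 x4 x5) =
    c000 (l3 A) (c000 (l3 A) x1 x2 x3) x4 x5
    + c000 (l3 A) x3 (c000 (l3 A) x1 x2 x4) x5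
    + c000 (l3 A) x3 x4 (c000 (l3 A) x1 x2 x5).
Proof.
by apply/eqP; rewrite eq_sym -subr_eq0 -axiom_d diff_skeletal.
Qed.

Definition lie3_of_skeletal : lie3 V0 :=
  Lie3 (c000_trilinear A) (c000_skew A) fundamental_of_skeletal.

Lemma der0_derivation x y z :
  der0 D (c000 (l3 A) x y z) = c000 (l3 A) (der0 D x) y z
    + c000 (l3 A) x (der0 D y) z + c000 (l3 A) x y (der0 D z).
Proof.
apply: (eq_of_subr (esym (der_b D x y z))).
by rewrite diff_skeletal; additive.
Qed.

Definition pair_of_skeletal : lie3Der V0 :=
  @Lie3Der _ _ lie3_of_skeletal (der0 D) der0_derivation.

Let P := pair_of_skeletal.

Lemma rho_of_bilinear : bilinear2 (rho_of A).
Proof.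
by have [lin1 lin2 _] := c001_trilinear A;
  split=> *; move=> a x y; apply/lfunP => u;
  rewrite !lfunE /= !lfunE /= !rho_ofE (lin1, lin2).
Qed.

Lemma rho_of_skew : skew2 (rho_of A).
Proof. by move=> x y; apply/lfunP => u; rewrite !lfunE /= !rho_ofE c001_skew. Qed.

Lemma l5_0l x2 x3 x4 x5 : l5 A 0 x2 x3 x4 x5 = 0.
Proof. by have [l1 _ _ _ _] := l5_linear A; rewrite (linear_fun0 (l1 _ _ _ _)). Qed.

Lemma l5_0m x1 x2 x4 x5 : l5 A x1 x2 0 x4 x5 = 0.
Proof. by have [_ _ l _ _] := l5_linear A; rewrite (linear_fun0 (l _ _ _ _)). Qed.

Lemma rho_of_rho x1 x2 x3 x4 :
  (rho_of A x1 x2 \o rho_of A x3 x4)%VF =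
    rho_of A (br P x1 x2 x3) x4 + rho_of A x3 (br P x1 x2 x4)
    + (rho_of A x3 x4 \o rho_of A x1 x2)%VF.
Proof.
apply/lfunP => u; rewrite !(add_lfunE, opp_lfunE, comp_lfunE, rho_ofE).
apply: (eq_of_subr (axiom_f A x1 x2 u x3 x4)).
by rewrite diff_skeletal l5_0m !c100E; additive.
Qed.

Lemma rho_of_bracket x1 x2 x3 x4 :
  rho_of A x1 (br P x2 x3 x4) =
    (rho_of A x3 x4 \o rho_of A x1 x2)%VF - (rho_of A x2 x4 \o rho_of A x1 x3)%VF
    + (rho_of A x2 x3 \o rho_of A x1 x4)%VF.
Proof.
apply/lfunP => u; rewrite !(add_lfunE, opp_lfunE, comp_lfunE, rho_ofE).
apply: (eq_of_subr (axiom_e A u x1 x2 x3 x4)).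
by rewrite diff_skeletal l5_0l !(c100E, c010E); additive.
Qed.

Lemma rho_of_theta x y :
  (der1 D \o rho_of A x y)%VF - (rho_of A x y \o der1 D)%VF =
    rho_of A (theta P x) y + rho_of A x (theta P y).
Proof.
apply/lfunP => u; rewrite !(add_lfunE, opp_lfunE, comp_lfunE, rho_ofE).
have [_ _ lX_lin] := lX_trilinear D.
apply: (eq_of_subr (esym (der_c D x y u))).
by rewrite diff_skeletal (linear_fun0 (lX_lin _ _)); additive.
Qed.

Definition representation_of_skeletal : representation P V1 :=
  Representation rho_of_bilinear rho_of_skew rho_of_rho rho_of_bracket
    rho_of_theta.

Let R := representation_of_skeletal.

Definition alpha3_of_skeletal : cochain V0 V1 2 :=
  Cochain ((cochain_of5P (l5 A)).2
    (And3 (l5_linear A) (@l5_skew12 _ _ _ A) (@l5_skew345 _ _ _ A))).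

Definition alpha2_of_skeletal : cochain V0 V1 1 :=
  Cochain ((cochain_of3P (lX D)).2 (conj (lX_trilinear D) (lX_skew D))).

Lemma cocycle1_of_skeletal X z :
  (partial R (alpha3_of_skeletal, alpha2_of_skeletal)).1 X z = 0.
Proof.
rewrite -(slots3K X); move: (X ord0) (X (lift _ _)) (X ord_max).
move=> [x1 x2] [x3 x4] [x5 x6].
rewrite /= cobord5E /= !rho_ofE.
apply: (eq_of_subr (axiom_g A x1 x2 x3 x4 x5 x6 z)).
by rewrite !(c100E, c010E) /br /=; additive.
Qed.

Lemma cocycle2_of_skeletal X z :
  (partial R (alpha3_of_skeletal, alpha2_of_skeletal)).2 X z = 0.
Proof.
rewrite -(slots2K X); move: (X ord0) (X ord_max) => [x1 x2] [x3 x4].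
rewrite /= cobord3E delta5E /= !rho_ofE.
rewrite !exprS expr0 !(mulr1, mulN1r) opprK scaleN1r.
apply: (eq_of_subr (der_d D x1 x2 x3 x4 z)).
by rewrite !(c100E, c010E) /br /=; additive.
Qed.

Definition triple_of_skeletal : triple_on V0 V1 :=
  TripleOn (Cocycle3 cocycle1_of_skeletal cocycle2_of_skeletal).

Lemma triple_of_skeletalP : same_data S triple_of_skeletal.
Proof. by do !split => //; move=> x y; exact: rho_ofE. Qed.

End SkeletalToTriple.

(** * From a triple to a skeletal pair *)

Section TripleToSkeletal.

Variables (F : fieldType) (V0 V1 : vectType F) (T : triple_on V0 V1).
Let P := tr_pair T.
Let R := tr_rep T.
Let c := tr_cocycle T.

(** The right-hand side of [l3E], with the action in place of the mixed
    component; it is the bracket of the semidirect product of L and V. *)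
Definition l3_of_triple (p q r : V0 * V1) : V0 * V1 :=
  (br P p.1 q.1 r.1,
   rho R p.1 q.1 r.2 - rho R p.1 r.1 q.2 + rho R q.1 r.1 p.2).

Definition l5_of_triple (x1 x2 x3 x4 x5 : V0) : V1 :=
  alpha3 c (slots2 (x1, x2) (x3, x4)) x5.

Definition lX_of_triple (x1 x2 x3 : V0) : V1 := alpha2 c (slots1 (x1, x2)) x3.

(** A cochain takes a finite family of wedge slots; these two lemmas turn it
    into a map of vectors, to which the low-degree formulas apply. *)
Lemma alpha3E : alpha3 c = cochain_of5 l5_of_triple :> (_ -> _ -> _).
Proof.
apply/funext => X; apply/funext => z.
by rewrite /cochain_of5 /l5_of_triple -!surjective_pairing slots2K.
Qed.

Lemma alpha2E : alpha2 c = cochain_of3 lX_of_triple :> (_ -> _ -> _).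
Proof.
apply/funext => X; apply/funext => z.
by rewrite /cochain_of3 /lX_of_triple -!surjective_pairing slots1K.
Qed.

Lemma l5_of_tripleP : is_cochain (cochain_of5 l5_of_triple).
Proof. by rewrite -alpha3E; exact: cochainP. Qed.

Lemma l5_of_triple_linear : quinquelinear l5_of_triple.
Proof. by have [] := (cochain_of5P _).1 l5_of_tripleP. Qed.

Lemma l5_of_triple_skew12 x3 x4 x5 :
  skew2 (fun x1 x2 => l5_of_triple x1 x2 x3 x4 x5).
Proof. by have [_ skew12 _] := (cochain_of5P _).1 l5_of_tripleP. Qed.

Lemma l5_of_triple_skew345 x1 x2 : skew3 (l5_of_triple x1 x2).
Proof. by have [_ _ skew345] := (cochain_of5P _).1 l5_of_tripleP. Qed.

Lemma lX_of_tripleP : trilinear lX_of_triple /\ skew3 lX_of_triple.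
Proof. by apply/cochain_of3P; rewrite -alpha2E; exact: cochainP. Qed.

Lemma rho0l y : rho R 0 y = 0.
Proof. exact: linear_fun0 ((rho_bilinear R).1 y). Qed.

Lemma rho0r x : rho R x 0 = 0.
Proof. exact: linear_fun0 ((rho_bilinear R).2 x). Qed.

Lemma br_trilinear : trilinear (br P).
Proof. exact: bracket_trilinear. Qed.

Lemma br0l y z : br P 0 y z = 0.
Proof. by have [lin1 _ _] := br_trilinear; exact: linear_fun0 (lin1 y z). Qed.

Lemma br0r x y : br P x y 0 = 0.
Proof. by have [_ _ lin3] := br_trilinear; exact: linear_fun0 (lin3 x y). Qed.

Lemma c000_of_triple x y z : c000 l3_of_triple x y z = br P x y z.
Proof. by []. Qed.

Lemma c001_of_triple x y u : c001 l3_of_triple x y u = rho R x y u.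
Proof. by rewrite /c001 /= !linear0 !addr0. Qed.

Lemma c010_of_triple x y u : c010 l3_of_triple x u y = - rho R x y u.
Proof. by rewrite /c010 /= !linear0 sub0r addr0. Qed.

Lemma c100_of_triple x y u : c100 l3_of_triple u x y = rho R x y u.
Proof. by rewrite /c100 /= !linear0 !add0r. Qed.

Let cE := (c000_of_triple, c001_of_triple, c010_of_triple, c100_of_triple).

Lemma l3_of_triple_trilinear : trilinear l3_of_triple.
Proof.
have [br1 br2 br3] := br_trilinear; have [rho1 rho2] := rho_bilinear R.
split=> p q a u v; congr pair; rewrite /= ?(br1, br2, br3) //.
- rewrite !rho1 !(add_lfunE, scale_lfunE, linearP) !(scalerDr, scalerN).
  by additive.
- rewrite rho1 rho2 !(add_lfunE, scale_lfunE, linearP) !(scalerDr, scalerN).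
  by additive.
- rewrite !rho2 !(add_lfunE, scale_lfunE, linearP) !(scalerDr, scalerN).
  by additive.
Qed.

Lemma l3_of_triple_skew : skew3 l3_of_triple.
Proof.
have [br12 br23] := bracket_skew (lie3_of P).
split=> p q r; congr pair; rewrite /=.
- by rewrite [LHS]br12.
- by rewrite (rho_skew R p.1 q.1) opp_lfunE; additive.
- by rewrite [LHS]br23.
- by rewrite (rho_skew R q.1 r.1) opp_lfunE; additive.
Qed.

Lemma l3_of_triple_degree1 x y u : (l3_of_triple (dg0 x) (dg0 y) (dg1 u)).1 = 0.
Proof. exact: br0r. Qed.

Lemma l3_of_triple_degree0 x y z : (l3_of_triple (dg0 x) (dg0 y) (dg0 z)).2 = 0.
Proof. by rewrite /= !linear0 !addr0. Qed.

Lemma l3_of_triple_b3 u v w : l3_of_triple (dg1 u) (dg1 v) (dg1 w) = 0.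
Proof. by congr pair; rewrite /= ?br0r // !rho0r !lfunE subr0 addr0. Qed.

Lemma l3_of_triple_b2 u v x : l3_of_triple (dg1 u) (dg1 v) (dg0 x) = 0.
Proof. by congr pair; rewrite /= ?br0l // !rho0l !lfunE subr0 addr0. Qed.

Local Notation l3 := l3_of_triple.
Local Notation l5 := l5_of_triple.
Local Notation lX := lX_of_triple.

Let zero_diff : 'Hom(V1, V0) := 0.

Lemma l3_of_triple_a x y u :
  zero_diff (c001 l3_of_triple x y u) = c000 l3_of_triple x y (zero_diff u).
Proof. by rewrite !lfunE /= c000_of_triple br0r. Qed.

Lemma l3_of_triple_c u v x :
  c010 l3_of_triple (zero_diff u) v x = c100 l3_of_triple u (zero_diff v) x.
Proof. by rewrite !cE !lfunE /= rho0l !lfunE oppr0. Qed.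

Lemma l3_of_triple_d x1 x2 x3 x4 x5 :
  zero_diff (l5_of_triple x1 x2 x3 x4 x5) =
    c000 l3 (c000 l3 x1 x2 x3) x4 x5 + c000 l3 x3 (c000 l3 x1 x2 x4) x5
    + c000 l3 x3 x4 (c000 l3 x1 x2 x5) - c000 l3 x1 x2 (c000 l3 x3 x4 x5).
Proof. by rewrite lfunE /= !cE /br (bracket_fundamental _ x1) subrr. Qed.

Lemma l3_of_triple_e u x2 x3 x4 x5 :
  l5_of_triple (zero_diff u) x2 x3 x4 x5 =
    c100 l3 (c100 l3 u x2 x3) x4 x5 + c010 l3 x3 (c100 l3 u x2 x4) x5
    + c001 l3 x3 x4 (c100 l3 u x2 x5) - c100 l3 u x2 (c000 l3 x3 x4 x5).
Proof.
have [lin1 _ _ _ _] := l5_of_triple_linear.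
rewrite lfunE /= (linear_fun0 (lin1 _ _ _ _)) !cE rho_bracket.
by rewrite !(add_lfunE, opp_lfunE, comp_lfunE); additive.
Qed.

Lemma l3_of_triple_f x1 x2 u x4 x5 :
  l5_of_triple x1 x2 (zero_diff u) x4 x5 =
    c100 l3 (c001 l3 x1 x2 u) x4 x5 + c100 l3 u (c000 l3 x1 x2 x4) x5
    + c100 l3 u x4 (c000 l3 x1 x2 x5) - c001 l3 x1 x2 (c100 l3 u x4 x5).
Proof.
have [_ _ lin3 _ _] := l5_of_triple_linear.
rewrite lfunE /= (linear_fun0 (lin3 _ _ _ _)) !cE.
rewrite -[rho R x1 x2 (rho R x4 x5 u)]comp_lfunE rho_rho.
by rewrite !(add_lfunE, opp_lfunE, comp_lfunE); additive.
Qed.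

Lemma l3_of_triple_g x1 x2 x3 x4 x5 x6 x7 :
  c100 l3 (l5 x1 x2 x3 x4 x5) x6 x7 + c010 l3 x5 (l5 x1 x2 x3 x4 x6) x7
  + c001 l3 x1 x2 (l5 x3 x4 x5 x6 x7) + c001 l3 x5 x6 (l5 x1 x2 x3 x4 x7)
  + l5 x1 x2 (c000 l3 x3 x4 x5) x6 x7 + l5 x1 x2 x5 (c000 l3 x3 x4 x6) x7
  + l5 x1 x2 x5 x6 (c000 l3 x3 x4 x7) =
    c001 l3 x3 x4 (l5 x1 x2 x5 x6 x7) + l5 (c000 l3 x1 x2 x3) x4 x5 x6 x7
    + l5 x3 (c000 l3 x1 x2 x4) x5 x6 x7 + l5 x3 x4 (c000 l3 x1 x2 x5) x6 x7
    + l5 x3 x4 x5 (c000 l3 x1 x2 x6) x7 + l5 x1 x2 x3 x4 (c000 l3 x5 x6 x7)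
    + l5 x3 x4 x5 x6 (c000 l3 x1 x2 x7).
Proof.
have := partial1_eq0 c (slots3 (x1, x2) (x3, x4) (x5, x6)) x7.
rewrite /= alpha3E cobord5E => /eq_of_subr; apply.
by rewrite !cE; additive.
Qed.

Definition alg_of_triple : lie3_2alg V0 V1 :=
  Lie3_2alg l3_of_triple_trilinear l3_of_triple_skew l3_of_triple_degree0
    l3_of_triple_degree1 l5_of_triple_linear l5_of_triple_skew12
    l5_of_triple_skew345 l3_of_triple_a l3_of_triple_b3 l3_of_triple_b2
    l3_of_triple_c l3_of_triple_d l3_of_triple_e l3_of_triple_f l3_of_triple_g.

Lemma der_d_of_triple x1 x2 x3 x4 x5 :
  thetaV R (l5 x1 x2 x3 x4 x5) =
    lX (c000 l3 x1 x2 x3) x4 x5 + lX x3 (c000 l3 x1 x2 x4) x5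
    + lX x3 x4 (c000 l3 x1 x2 x5) - lX x1 x2 (c000 l3 x3 x4 x5)
    + c100 l3 (lX x1 x2 x3) x4 x5 + c010 l3 x3 (lX x1 x2 x4) x5
    + c001 l3 x3 x4 (lX x1 x2 x5) - c001 l3 x1 x2 (lX x3 x4 x5)
    + (l5 (theta P x1) x2 x3 x4 x5 + l5 x1 (theta P x2) x3 x4 x5
       + l5 x1 x2 (theta P x3) x4 x5 + l5 x1 x2 x3 (theta P x4) x5
       + l5 x1 x2 x3 x4 (theta P x5)).
Proof.
have := partial2_eq0 c (slots2 (x1, x2) (x3, x4)) x5.
rewrite /= alpha3E alpha2E cobord3E delta5E !exprS expr0 !(mulr1, mulN1r).
by rewrite opprK scaleN1r => /eq_of_subr; apply; rewrite !cE; additive.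
Qed.

Lemma der_a_of_triple : (theta P \o zero_diff)%VF = (zero_diff \o thetaV R)%VF.
Proof. by apply/lfunP => u; rewrite !(comp_lfunE, zero_lfunE) linear0. Qed.

Lemma der_b_of_triple x y z :
  zero_diff (lX x y z) =
    theta P (c000 l3 x y z) - c000 l3 (theta P x) y z
    - c000 l3 x (theta P y) z - c000 l3 x y (theta P z).
Proof. by rewrite zero_lfunE !cE /br theta_derivation; additive. Qed.

Lemma der_c_of_triple x y v :
  lX x y (zero_diff v) =
    thetaV R (c001 l3 x y v) - c001 l3 (theta P x) y v
    - c001 l3 x (theta P y) v - c001 l3 x y (thetaV R v).
Proof.
have [[_ _ lin3] _] := lX_of_tripleP; rewrite zero_lfunE (linear_fun0 (lin3 _ _)).
have /lfunP/(_ v) := rho_theta R x y.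
rewrite !(add_lfunE, opp_lfunE, comp_lfunE) => /esym /eq_of_subr; apply.
by rewrite !cE; additive.
Qed.

Definition der_of_triple : derivation2 alg_of_triple :=
  @Derivation2 _ _ _ alg_of_triple (theta P) (thetaV R) lX lX_of_tripleP.1
    lX_of_tripleP.2 der_a_of_triple der_b_of_triple der_c_of_triple
    der_d_of_triple.

Definition skeletal_of_triple : skeletal_pair_on V0 V1 :=
  @SkeletalPairOn _ _ _ alg_of_triple erefl der_of_triple.

Lemma skeletal_of_tripleP : same_data skeletal_of_triple T.
Proof.
do !split.
- by move=> x y u; rewrite c001_of_triple.
- by move=> X z; rewrite -/c alpha3E.
- by move=> X z; rewrite -/c alpha2E.
Qed.

End TripleToSkeletal.

(** * Uniqueness of the partner *)

Section SameData.

Variables (F : fieldType) (V0 V1 : vectType F).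
Implicit Types (S : skeletal_pair_on V0 V1) (T : triple_on V0 V1).

Lemma lie3_ext (L : vectType F) (A B : lie3 L) :
  bracket A = bracket B -> A = B.
Proof.
case: A B => [b1 p1 q1 r1] [b2 p2 q2 r2] /= e; case: _ / e in p2 q2 r2 *.
by congr Lie3; exact: Prop_irrelevance.
Qed.

Lemma lie3Der_ext (L : vectType F) (P Q : lie3Der L) :
  br P = br Q -> theta P = theta Q -> P = Q.
Proof.
case: P Q => [A t1 p1] [B t2 p2] /lie3_ext /= e; case: _ / e in p2 *.
by move=> e; case: _ / e in p2 *; congr Lie3Der; exact: Prop_irrelevance.
Qed.

Lemma representation_ext (L V : vectType F) (P : lie3Der L)
    (R Q : representation P V) :
  rho R = rho Q -> thetaV R = thetaV Q -> R = Q.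
Proof.
case: R Q => [r1 a1 b1 t1 c1 d1 e1] [r2 a2 b2 t2 c2 d2 e2] /= er et.
case: _ / er in a2 b2 c2 d2 e2 *; case: _ / et in e2 *.
rewrite (Prop_irrelevance a1 a2) (Prop_irrelevance b1 b2).
rewrite (Prop_irrelevance c1 c2) (Prop_irrelevance d1 d2).
by rewrite (Prop_irrelevance e1 e2).
Qed.

Lemma cochain_ext (L V : vectType F) n (f g : cochain L V n) :
  (forall X z, f X z = g X z) -> f = g.
Proof.
case: f g => [f fP] [g gP] /= fg.
have e : f = g by apply/funext => X; apply/funext.
by case: _ / e in gP *; congr Cochain; exact: Prop_irrelevance.
Qed.

Lemma cocycle3_ext (L V : vectType F) (P : lie3Der L) (R : representation P V)
    (b c : cocycle3 R) :
  alpha3 b = alpha3 c -> alpha2 b = alpha2 c -> b = c.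
Proof.
case: b c => [a3 a2 p1 p2] [a3' a2' q1 q2] /= e3 e2.
case: _ / e3 in q1 q2 *; case: _ / e2 in q1 q2 *.
by congr Cocycle3; exact: Prop_irrelevance.
Qed.

Lemma lie3_2alg_ext (A B : lie3_2alg V0 V1) :
  diff A = diff B -> l3 A = l3 B -> l5 A = l5 B -> A = B.
Proof.
case: A B => [d l m ? ? ? ? ? ? ? ? ? ? ? ? ? ? ?]
  [d' l' m' ? ? ? ? ? ? ? ? ? ? ? ? ? ? ?] /= ed el em.
subst d' l' m'; congr Lie3_2alg; exact: Prop_irrelevance.
Qed.

Lemma derivation2_ext (A : lie3_2alg V0 V1) (D E : derivation2 A) :
  der0 D = der0 E -> der1 D = der1 E -> lX D = lX E -> D = E.
Proof.
case: D E => [d0 d1 l ? ? ? ? ? ?] [d0' d1' l' ? ? ? ? ? ?] /= e0 e1 el.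
subst d0' d1' l'; congr Derivation2; exact: Prop_irrelevance.
Qed.

Lemma same_data_inj_triple S T T' : same_data S T -> same_data S T' -> T = T'.
Proof.
case: T T' => [P R c] [P' R' c'] [/= eb [et [er [ev [e3 e2]]]]].
move=> [/= eb' [et' [er' [ev' [e3' e2']]]]].
have eP : P = P'.
  apply: lie3Der_ext; last by rewrite et et'.
  by do 3!apply/funext => ?; rewrite eb eb'.
case: _ / eP in R' c' eb' et' er' ev' e3' e2' *.
have eR : R = R'.
  apply: representation_ext; last by rewrite ev ev'.
  by do 2!apply/funext => ?; apply/lfunP => u; rewrite er er'.
case: _ / eR in c' er' ev' e3' e2' *.
by congr TripleOn; apply: cocycle3_ext; apply: cochain_ext => X z;
  rewrite (e3, e2) (e3', e2').
Qed.

(** [same_data] fixes only two components of l_3; the rest of l_3 is recovered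
    from them by [l3E]. *)
Lemma same_data_inj_skeletal S S' T : same_data S T -> same_data S' T -> S = S'.
Proof.
case: S S' => [A sA D] [A' sA' D'] [/= eb [et [er [ev [e3 e2]]]]].
move=> [/= eb' [et' [er' [ev' [e3' e2']]]]].
have eA : A = A'.
  apply: lie3_2alg_ext; first by rewrite sA sA'.
    apply/funext => p; apply/funext => q; apply/funext => r.
    by rewrite !l3E -!eb -!er -!eb' -!er'.
  apply/funext => x1; apply/funext => x2; apply/funext => x3.
  apply/funext => x4; apply/funext => x5.
  have := e3 (slots2 (x1, x2) (x3, x4)) x5.
  by rewrite e3' !ffunE.
case: _ / eA in sA' D' eb' et' er' ev' e3' e2' *.
have eD : D = D'.
  apply: derivation2_ext; first by rewrite -et -et'.
    by rewrite -ev -ev'.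
  apply/funext => x1; apply/funext => x2; apply/funext => x3.
  by have := e2 (slots1 (x1, x2)) x3; rewrite e2' !ffunE.
by rewrite eD (Prop_irrelevance sA sA').
Qed.

End SameData.

Theorem proposition5p1 (F : closedFieldType) (charF0 : [pchar F] =i pred0) :
  exists f : skeletal_pair F -> triple F,
    bijective f
    /\ forall (V0 V1 : vectType F) (S : skeletal_pair_on V0 V1),
         exists2 T : triple_on V0 V1,
           f (SkeletalPair S) = Triple T & same_data S T.
Proof.
exists (fun p => Triple (triple_of_skeletal (sp_structure p))); split; last first.
  by move=> V0 V1 S; exists (triple_of_skeletal S) => //; exact: triple_of_skeletalP.
exists (fun t => SkeletalPair (skeletal_of_triple (tr_structure t))).
- case=> V0 V1 S; congr SkeletalPair => /=.
  exact: same_data_inj_skeletal (skeletal_of_tripleP _) (triple_of_skeletalP S).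
- case=> V0 V1 T; congr Triple => /=.
  exact: same_data_inj_triple (triple_of_skeletalP _) (skeletal_of_tripleP T).
Qed.
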